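(* If $D=2$, then $R_{k,3}$ is irreducible over $\mathbb{Q}$ for all $k\geq 2$.
   Context: Let $D\geq 2$ be an integer and, for $a\in\mathbb{C}$, let $f_a(z)=az^D+1$, with critical point $0$. A point $z$ is periodic for $f_a$ with period $n\geq 1$ if $f_a^{\circ n}(z)=z$ and $n$ is the least such integer; it is preperiodic with preperiod $k\geq 0$ and period $n$ if $k$ is the least nonnegative integer such that $f_a^{\circ k}(z)$ is periodic, and $f_a^{\circ k}(z)$ has period $n$. For $n\geq 1$, $P_n\in\mathbb{Z}[a]$ is defined by $P_n(a)=f_a^{\circ n}(0)$, i.e. $P_1=1$ and $P_{n+1}=aP_n^D+1$. For $k\geq 2$, $n\geq 1$ and $d\geq 2$ dividing $D$, $R_{k,n,d}$ is the monic polynomial with simple roots whose roots are the parameters $a\in\mathbb{C}$ such that $0$ is preperiodic for $f_a$ with preperiod $k$ and period $n$, and $f_a^{\circ(k+n-1)}(0)=\omega f_a^{\circ(k-1)}(0)$ for some primitive $d$-th root of unity $\omega$. It belongs to $\mathbb{Z}[a]$; equivalently, $R_{k,n,d}=\prod_{m\mid n}\left(P_{k,m,d}/P_{\gcd(m,k-1)}^{\varphi(d)}\right)^{\mu(n/m)}$, where $P_{k,m,d}:=\prod_{\omega}(P_{k+m-1}-\omega P_{k-1})$ (product over primitive $d$-th roots of unity), $\mu$ is the Möbius function and $\varphi$ is the Euler totient function. Finally, $R_{k,n}:=\prod_{d\mid D,\ d\neq 1}R_{k,n,d}\in\mathbb{Z}[a]$. *)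

(* Defs.v *)
From mathcomp Require Import all_boot all_order all_algebra.
From mathcomp Require Import complex.
From mathcomp Require Import classical_sets fsbigop reals.

Set Implicit Arguments.
Unset Strict Implicit.
Unset Printing Implicit Defensive.

Import GRing.Theory.
Local Open Scope ring_scope.
Local Open Scope classical_set_scope.

Section Dynamics.
Variables (T : Type) (f : T -> T).

Definition has_period (n : nat) (z : T) : Prop :=
  [/\ (0 < n)%N, iter n f z = z &
      forall m : nat, (0 < m < n)%N -> iter m f z <> z].

Definition preperiodic (k n : nat) (z : T) : Prop :=
  has_period n (iter k f z) /\
  forall j : nat, (j < k)%N -> ~ exists m : nat, has_period m (iter j f z).

End Dynamics.

Section MisiurewiczPolynomials.
Variables (R : realType) (D : nat).

Definition unicritical (a z : R[i]) : R[i] := a * z ^+ D + 1.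

(* k is meant to be at least 2, so that the truncated predecessors agree with
   k + n - 1 and k - 1 *)
Definition misiurewicz (k n d : nat) : set R[i] :=
  [set a | preperiodic (unicritical a) k n 0 /\
     exists2 w : R[i], d.-primitive_root w &
       iter (k + n).-1 (unicritical a) 0 = w * iter k.-1 (unicritical a) 0].

(* This is the monic polynomial whose roots are all simple and are exactly the
   elements of [misiurewicz k n d].  For D >= 2, k >= 2 and n >= 1 this set is
   finite; the operator would return 1 on an infinite set. *)
Definition Rknd (k n d : nat) : {poly R[i]} :=
  \big[*%R/1]_(a \in misiurewicz k n d) ('X - a%:P).

Definition Rkn (k n : nat) : {poly R[i]} :=
  \prod_(d <- divisors D | d != 1%N) Rknd k n d.

End MisiurewiczPolynomials.

(* Main.v *)
Require Import Defs.
From mathcomp Require Import all_boot all_order all_algebra.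
From mathcomp Require Import complex.
From mathcomp Require Import reals.
From mathcomp Require Import classical_sets fsbigop.
From mathcomp Require Import separable ring zify.

(** Put m = k - 1 and let P_n in Z[X] be the n-th iterate of 0 under
    z |-> X z^2 + 1.  For D = 2 the only primitive root of unity involved is
    -1, so the parameters in question satisfy P_{m+3} + P_m = 0.  Those for
    which the cycle is a fixed point satisfy P_{m+1} + P_m = 0, and there is an
    explicit factorization

      P_{m+3} + P_m = (P_{m+1} + P_m) * S                                  (1)

    in Z[X].  Write S = r * g, where g = P_3 when 3 divides m and g = 1
    otherwise; the claim is that r is the required polynomial.

    Irreducibility of r comes from the prime 2, by a criterion of Eisenstein
    type that goes back to Schonemann (schonemann_irreducible).  Modulo 2,
    squaring is additive, so P_{m+j} + P_m = X^(2^m - 1) P_j^(2^m), and (1)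
    gives S = P_3^(2^m) mod 2 (period3_quotient_mod2).  Now P_3 = X^3 + X + 1
    mod 2 is irreducible, so every nonconstant factor of r over Z is divisible
    by P_3 modulo 2.  If r = f h with two such factors, then r would belong to
    the ideal (4, P_3).  But modulo P_3 the critical point is periodic of period
    3, so that S can be computed modulo P_3^2 from the residue of m modulo 3,
    and r is 2 u modulo P_3 with u prime to P_3 modulo 2
    (period3_quotient_factor): a contradiction.

    It remains to see that r has simple roots, which are the Misiurewicz
    parameters.  Simplicity follows from irreducibility in characteristic 0.
    The dynamical condition on a means exactly that P_{m+3} + P_m vanishes at a
    while P_{m+1} + P_m and P_3 do not (misiurewicz_period3P); by (1) such an a
    is a root of r.  Conversely a root of r annihilates neither P_{m+1} + P_m
    nor P_3, since these are nonzero integer polynomials of smaller degree than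
    the irreducible r. *)

Import Order.TTheory GRing.Theory Num.Theory.

Local Open Scope ring_scope.

Local Notation pZto A := (map_poly (intr : int -> A)).

(** * The Schonemann criterion *)

Section ReductionModPrime.

Variables (l : nat).
Hypothesis l_pr : prime l.

Local Notation redl := (pZto 'F_l).

Lemma redl_eq0 (h : {poly int}) : redl h = 0 -> exists h', h = h' *+ l.
Proof.
move=> h0; have /polyOver_dvdzP[h' ->] : h \is a polyOver (dvdz l).
  apply/polyOverP=> i; rewrite (dvdz_pcharf (pchar_Fp l_pr)).
  by have /polyP/(_ i) := h0; rewrite coef_map coef0 => ->.
by exists h'; rewrite -scaler_nat natz.
Qed.

Lemma redl_surj (v : {poly 'F_l}) : exists h, redl h = v.
Proof.
exists (map_poly (fun x : 'F_l => (x : nat)%:Z) v).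
by apply/polyP=> i; rewrite coef_map coef_map_id0 //= -pmulrn natr_Zp.
Qed.

(** If r = f g with nonconstant f and g, then modulo l both factors are
    nonconstant (r is monic) and divide a power of the irreducible p, so p
    divides both of them.  Hence f = p f1 + l f2 and g = p g1 + l g2; comparing
    f g with l u + p t shows that l divides the cofactor of p in the difference,
    and after division by l that p divides u modulo l. *)
Lemma schonemann_irreducible (p r u t : {poly int}) (N : nat) :
  r \is monic -> (1 < size r)%N -> irreducible_poly (redl p) ->
  redl r %| redl p ^+ N -> r = u *+ l + p * t -> ~~ (redl p %| redl u) ->
  irreducible_poly r.
Proof.
move=> r_mon r_gt1 p_irr r_dv_pN Dr p_ndv_u.
suff no_factors (f g : {poly int}) :
    r = f * g -> (1 < size f)%N -> (1 < size g)%N -> False.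
  (* By Gauss, a divisor q of r over the fraction field gives the integral
     factorization r = zprimitive q * g; here g is constant exactly when q and
     r are associated. *)
  split=> // q q_neq1 /[dup] q_dv /dvdpP_int [g Drqg].
  rewrite -(dvdp_size_eqp q_dv); move: Drqg.
  have r_neq0 := monic_neq0 r_mon.
  have [-> | q_neq0] := eqVneq q 0.
    by rewrite zprimitive0 mul0r => r0; rewrite r0 eqxx in r_neq0.
  have q_gt1 : (1 < size q)%N by rewrite ltn_neqAle eq_sym q_neq1 size_poly_gt0.
  move=> Drqg; have g_neq0 : g != 0.
    by apply: contraNneq r_neq0 => g0; rewrite Drqg g0 mulr0.
  have [g_le1 | g_gt1] := leqP (size g) 1; last first.
    by have [] := no_factors _ _ Drqg _ g_gt1; rewrite size_zprimitive.
  have g1 : size g = 1%N by apply/eqP; rewrite eqn_leq g_le1 size_poly_gt0.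
  by rewrite Drqg size_mul ?zprimitive_eq0 // g1 size_zprimitive addn1.
move=> Drfg f_gt1 g_gt1; move: p_ndv_u; apply/negP; rewrite negbK.
have p_dv (h h' : {poly int}) : h * h' = r -> (1 < size h)%N ->
    exists x y, h = p * x + y *+ l.
  move=> Dh h_gt1.
  have lc_h : (lead_coef h)%:~R != 0 :> 'F_l.
    apply: contra_eq_neq (monicP r_mon) => lc0.
    rewrite -Dh lead_coefM; apply/eqP=> lc1.
    have : (lead_coef h * lead_coef h')%:~R = 1 :> 'F_l by rewrite lc1.
    by rewrite rmorphM /= lc0 mul0r => /esym/eqP; rewrite oner_eq0.
  have : redl p %| redl h.
    rewrite -[_ %| _]negbK -irreducible_poly_coprime //.
    apply/negP=> /(coprimep_expl N) /coprimepP/(_ (redl h)).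
    rewrite dvdpp -size_poly_eq1 size_map_poly_id0 // gtn_eqF //.
    suff h_dv : redl h %| redl p ^+ N by move=> /(_ h_dv isT).
    by apply: dvdp_trans r_dv_pN; rewrite -Dh rmorphM dvdp_mulr.
  case/dvdpP=> v Dv; have [x Dx] := redl_surj v.
  have [|y Dy] := redl_eq0 (h - p * x).
    by rewrite rmorphB rmorphM /= Dv Dx mulrC subrr.
  by exists x, y; rewrite -Dy addrC subrK.
have [f1 [f2 Df]] := p_dv _ _ (esym Drfg) f_gt1.
have [g1 [g2 Dg]] : exists x y, g = p * x + y *+ l.
  by apply: (p_dv _ f) => //; rewrite mulrC.
(* f g = p w + (f2 g2) l^2 *)
pose w := f1 * g1 * p + (f1 * g2 + f2 * g1) *+ l.
have eq_tw : p * (t - w) = ((f2 * g2) *+ l - u) *+ l.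
  have Ep : p * t = f * g - u *+ l by rewrite -Drfg Dr addrC addKr.
  have [L nl] : exists L, forall h : {poly int}, h *+ l = L * h.
    by exists l%:R => h; rewrite mulr_natl.
  by rewrite mulrBr Ep Df Dg /w !nl; ring.
have l0 (h : {poly int}) : redl (h *+ l) = 0.
  by rewrite raddfMn /= -scaler_nat (pcharf0 (pchar_Fp l_pr)) scale0r.
have [s Ds] : exists s, t - w = s *+ l.
  apply: redl_eq0; apply: (mulfI (irredp_neq0 p_irr)).
  by rewrite -rmorphM eq_tw /= l0 mulr0.
have : p * s = (f2 * g2) *+ l - u.
  have l_neq0 : l%:R != 0 :> {poly int}.
    by rewrite -polyC_natr polyC_eq0 pnatr_eq0 -lt0n prime_gt0.
  by apply: (mulfI l_neq0); rewrite !mulr_natl -eq_tw Ds mulrnAr.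
move=> /(congr1 redl); rewrite rmorphM rmorphB /= l0 sub0r => /eqP.
by rewrite -eqr_oppLR -mulrN => /eqP <-; rewrite dvdp_mulr.
Qed.

End ReductionModPrime.

(** * The polynomials of the critical orbit *)

Section CriticalOrbit.

Variable A : comNzRingType.

(** The coefficient ring is arbitrary because the same polynomials are used over
    the integers, over the field with two elements and over the complexes. *)
Definition critical_orbit (n : nat) : {poly A} :=
  iter n (fun p => 'X * p ^+ 2 + 1) 0.

Arguments critical_orbit : simpl never.

Lemma critical_orbitS n :
  critical_orbit n.+1 = 'X * critical_orbit n ^+ 2 + 1.
Proof. by []. Qed.

Lemma critical_orbit3 : critical_orbit 3 = 'X * ('X + 1) ^+ 2 + 1.
Proof. by rewrite !critical_orbitS /critical_orbit /=; ring. Qed.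

Lemma critical_orbit_monic_size n :
  critical_orbit n.+1 \is monic /\ size (critical_orbit n.+1) = (2 ^ n)%N.
Proof.
elim: n => [|n [mon sz]].
  by rewrite /critical_orbit /= expr0n mulr0 add0r monic1 size_poly1.
have monX : 'X * critical_orbit n.+1 ^+ 2 \is monic.
  by rewrite monicMr ?monicX // monic_exp.
have szX : size ('X * critical_orbit n.+1 ^+ 2) = (2 ^ n.+1)%N.
  rewrite mulrC size_mulX ?monic_neq0 ?monic_exp //.
  rewrite expr2 size_Mmonic ?monic_neq0 // sz expnS.
  by have := expn_gt0 2 n; lia.
have lt1 : (size (1 : {poly A})%R < size ('X * critical_orbit n.+1 ^+ 2)%R)%N.
  by rewrite szX size_poly1 expnS; have := expn_gt0 2 n; lia.
rewrite critical_orbitS; split; last by rewrite size_polyDl.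
by rewrite monicE lead_coefDl // -monicE.
Qed.

(** The indices are shifted so that both are positive: the term of larger index
    has strictly larger degree, except when the smaller index is 0. *)
Lemma critical_orbitD_monic_size m j :
  critical_orbit (m + j.+2) + critical_orbit m.+1 \is monic /\
  size (critical_orbit (m + j.+2) + critical_orbit m.+1) = (2 ^ (m + j.+1))%N.
Proof.
rewrite addnS; have [mon sz] := critical_orbit_monic_size (m + j.+1).
have [_ sz'] := critical_orbit_monic_size m.
have lt : (size (critical_orbit m.+1) < size (critical_orbit (m + j.+1).+1))%N.
  by rewrite sz sz' ltn_exp2l //; lia.
split; last by rewrite size_polyDl.
by rewrite monicE lead_coefDl // -monicE.
Qed.

(** The quotient of P_{m+3} + P_m by P_{m+1} + P_m.  Since
    P_{n+2} - P_{n+1} = X (P_{n+1} - P_n) (P_{n+1} + P_n), this formula is what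
    remains when P_{m+1} + P_m is factored out of the telescoping sum
    (P_{m+3} - P_{m+2}) + (P_{m+2} - P_{m+1}) + (P_{m+1} + P_m). *)
Definition period3_quotient (m : nat) : {poly A} :=
  1 + 'X * (critical_orbit m.+1 - critical_orbit m)
        * (1 + 'X * (critical_orbit m.+2 + critical_orbit m.+1)).

Lemma period3_quotientE m :
  critical_orbit m.+3 + critical_orbit m =
    (critical_orbit m.+1 + critical_orbit m) * period3_quotient m.
Proof.
by rewrite /period3_quotient !(critical_orbitS _.+1) (critical_orbitS m); ring.
Qed.

(** In characteristic 2, x^2 + y^2 = (x + y)^2, so passing from m to m + 1
    squares the sum and multiplies it by X. *)
Lemma critical_orbit_char2 m j : 2%N \in [pchar A] ->
  critical_orbit (m + j) + critical_orbit m =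
    'X ^+ (2 ^ m).-1 * critical_orbit j ^+ (2 ^ m).
Proof.
move=> char2; have char2X : 2%N \in [pchar {poly A}] by rewrite pchar_poly.
elim: m => [|m IHm]; first by rewrite add0n addr0 expr0 mul1r expr1.
have sqrD (x y : {poly A}) : x ^+ 2 + y ^+ 2 = (x + y) ^+ 2.
  by rewrite sqrrD mulr2n (addrr_pchar2 char2X) addr0.
rewrite addSn !critical_orbitS addrACA (addrr_pchar2 char2X) addr0 -mulrDr.
rewrite sqrD IHm exprMn -!exprM mulrA -exprS -expnSr; congr ('X ^+ _ * _).
by rewrite expnS; have := expn_gt0 2 m; lia.
Qed.

End CriticalOrbit.

Arguments critical_orbit : simpl never.

(** * The quotient modulo the square of the third polynomial *)

Section CriticalOrbitModPeriod3.

Local Notation P := (critical_orbit int).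
Local Notation P3 := (P 3).

(** Congruence modulo P_3^2, with an explicit multiplier because divisibility
    of polynomials over the integers is only up to constants. *)
Definition eqmod_sqr (x y : {poly int}) := exists v, x = y + P3 ^+ 2 * v.

Lemma eqmod_sqr_step x y :
  eqmod_sqr x y -> eqmod_sqr ('X * x ^+ 2 + 1) ('X * y ^+ 2 + 1).
Proof.
case=> v ->; exists ('X * (2 * y * v + P3 ^+ 2 * v ^+ 2)).
by set c := P3; ring.
Qed.

(** Modulo P_3 the orbit of 0 is periodic of period 3.  Its part starting at
    P_1 is even periodic modulo P_3^2, since P_4 = X P_3^2 + 1: the critical
    point makes the cycle superattracting. *)
Lemma critical_orbit_mod_sqr j :
  [/\ eqmod_sqr (P (3 * j).+1) 1, eqmod_sqr (P (3 * j).+2) ('X + 1) &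
      eqmod_sqr (P (3 * j).+3) P3].
Proof.
suff e1 : eqmod_sqr (P (3 * j).+1) 1.
  have e2 := eqmod_sqr_step _ _ e1; rewrite expr1n mulr1 in e2.
  by have e3 := eqmod_sqr_step _ _ e2; rewrite -critical_orbit3 in e3.
elim: j => [|j e1]; first by exists 0; rewrite /critical_orbit /=; ring.
have e2 := eqmod_sqr_step _ _ e1; rewrite expr1n mulr1 in e2.
have e3 := eqmod_sqr_step _ _ e2; rewrite -critical_orbit3 in e3.
have [v Dv] := eqmod_sqr_step _ _ e3.
by rewrite mulnS; exists ('X + v); rewrite [LHS]Dv; set c := P3; ring.
Qed.

Lemma period3_quotient_mod_sqr m b0 b1 b2 :
    eqmod_sqr (P m) b0 -> eqmod_sqr (P m.+1) b1 -> eqmod_sqr (P m.+2) b2 ->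
  eqmod_sqr (period3_quotient int m)
            (1 + 'X * (b1 - b0) * (1 + 'X * (b2 + b1))).
Proof.
rewrite /period3_quotient => -[v0 ->] [v1 ->] [v2 ->].
exists ('X * (v1 - v0) * (1 + 'X * (b2 + b1)) + 'X * (b1 - b0) * ('X * (v2 + v1))
        + P3 ^+ 2 * ('X * (v1 - v0) * ('X * (v2 + v1)))).
by set c := P3; ring.
Qed.

(** The residue of m modulo 3 determines the quotient modulo P_3^2.  When
    3 divides m it is 2 P_3, so that one factor P_3 splits off and leaves 2
    modulo P_3; in the two other cases it is 2 (X^2 + 1) and 2 modulo P_3.
    It is this division by P_3 that calls for the modulus P_3^2. *)
Lemma period3_quotient_factor m : (0 < m)%N -> exists r u t : {poly int},
  [/\ period3_quotient int m = r * (if (3 %| m)%N then P3 else 1),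
      r = u *+ 2 + P3 * t & u = 1 \/ u = 'X ^+ 2 + 1].
Proof.
move=> m_gt0; have [j [|[] ]] : exists j,
    (m = (3 * j).+3) \/ (m = (3 * j).+1 \/ m = (3 * j).+2).
  by exists (m.-1 %/ 3)%N; lia.
- move=> ->; have [e1 e2 e3] := critical_orbit_mod_sqr j.
  have [e1' e2' _] := critical_orbit_mod_sqr j.+1; rewrite mulnS in e1' e2'.
  have [t Dt] := period3_quotient_mod_sqr _ _ _ _ e3 e1' e2'.
  exists (2 + P3 * (t - 1)), 1, (t - 1).
  rewrite (_ : 3 %| _)%N; last by lia.
  by rewrite Dt critical_orbit3; split; [ring|ring|left].
- move=> ->; have [e1 e2 e3] := critical_orbit_mod_sqr j.
  have [t Dt] := period3_quotient_mod_sqr _ _ _ _ e1 e2 e3.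
  exists (period3_quotient int (3 * j).+1), ('X ^+ 2 + 1).
  exists ('X - 1 + 'X ^+ 3 + P3 * t).
  rewrite (_ : 3 %| _ = false)%N; last by lia.
  by rewrite Dt critical_orbit3; split; [ring|ring|right].
move=> ->; have [e1 e2 e3] := critical_orbit_mod_sqr j.
have [e1' _ _] := critical_orbit_mod_sqr j.+1; rewrite mulnS in e1'.
have [t Dt] := period3_quotient_mod_sqr _ _ _ _ e2 e3 e1'.
exists (period3_quotient int (3 * j).+2), 1,
  ('X * (1 + 'X * (1 + P3)) - 'X ^+ 2 * ('X + 1) - 1 + P3 * t).
rewrite (_ : 3 %| _ = false)%N; last by lia.
by rewrite Dt critical_orbit3; split; [ring|ring|left].
Qed.

End CriticalOrbitModPeriod3.

(** * Reduction modulo 2 and irreducibility *)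

Lemma map_critical_orbit (A : comNzRingType) n :
  pZto A (critical_orbit int n) = critical_orbit A n.
Proof.
elim: n => [|n IHn]; first by rewrite /critical_orbit /= rmorph0.
by rewrite !critical_orbitS rmorphD rmorphM rmorphXn /= map_polyX IHn rmorph1.
Qed.

Lemma map_critical_orbitD (A : comNzRingType) i j :
  pZto A (critical_orbit int i + critical_orbit int j) =
    critical_orbit A i + critical_orbit A j.
Proof. by rewrite [LHS]rmorphD /= !map_critical_orbit. Qed.

Lemma critical_orbit3_irreducible_mod2 :
  irreducible_poly (critical_orbit 'F_2 3).
Proof.
have [_ sz] := critical_orbit_monic_size 'F_2 2.
apply: cubic_irreducible; first by rewrite sz.
move=> x; rewrite critical_orbit3 /root !hornerE.
by case: x => -[|[|[]]].
Qed.

(** Modulo 2 the sum P_{m+1} + P_m is X^(2^m - 1), because P_1 = 1.  It cancels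
    in the factorization of P_{m+3} + P_m = X^(2^m - 1) P_3^(2^m). *)
Lemma period3_quotient_mod2 m :
  pZto 'F_2 (period3_quotient int m) = critical_orbit 'F_2 3 ^+ (2 ^ m).
Proof.
have char2 : 2%N \in [pchar 'F_2] by apply: pchar_Fp.
have := congr1 (pZto 'F_2) (period3_quotientE int m).
rewrite [RHS]rmorphM /= !map_critical_orbitD.
rewrite -(addn3 m) -(addn1 m) !critical_orbit_char2 //.
rewrite (_ : critical_orbit 'F_2 1 = 1) ?expr1n ?mulr1; last first.
  by rewrite /critical_orbit /= expr0n mulr0 add0r.
by move/mulfI => <- //; rewrite expf_eq0 polyX_eq0 andbF.
Qed.

(** The bounds on the size say that P_3, of size 4, and P_{m+1} + P_m, of size
    2^m, both have smaller degree than r. *)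
Lemma irreducible_period3_factor m : (0 < m)%N -> exists r : {poly int},
  [/\ period3_quotient int m = r * (if (3 %| m)%N then critical_orbit int 3 else 1),
      r \is monic, irreducible_poly r, (4 < size r)%N & (2 ^ m < size r)%N].
Proof.
move=> m_gt0; have [r [u [t [Dr rE uE]]]] := period3_quotient_factor m m_gt0.
have charS : period3_quotient int m \is monic /\
    size (period3_quotient int m) = (3 * 2 ^ m).+1.
  have := period3_quotientE int m; case: (m) m_gt0 => // n _.
  have [] := critical_orbitD_monic_size int n 0; rewrite addn2 addn1.
  have [] := critical_orbitD_monic_size int n 2; rewrite addn4 addn3.
  move=> mon3 sz3 mon1 sz1 E.
  move: (mon3) (sz3); rewrite E monicMl // => monS.
  rewrite size_monicM // ?monic_neq0 // sz1 !expnS.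
  by have := expn_gt0 2 n; split=> //; lia.
have [monS szS] := charS.
have [mon3 sz3] := critical_orbit_monic_size int 2.
set g := if _ then _ else _ in Dr.
have mon_g : g \is monic by rewrite /g; case: ifP; rewrite ?monic1.
have mon_r : r \is monic by rewrite -(monicMr _ mon_g) -Dr.
have sz_r : (4 < size r)%N && (2 ^ m < size r)%N.
  move: szS; rewrite Dr size_Mmonic ?monic_neq0 // /g.
  have := ltn_expl m (ltnSn 1); case: ifP => [/dvdnP[j Dm] | _].
    rewrite sz3; case: j Dm m_gt0 => [|j] -> // _.
    rewrite mulSn expnD -[(2 ^ 3)%N]/8%N -[(2 ^ 2)%N]/4%N.
    have : (0 < 2 ^ (j * 3))%N by rewrite expn_gt0.
    move: (2 ^ (j * 3))%N (size r) => x y x_gt0 _ sz_r.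
    by clear -x_gt0 sz_r; apply/andP; split; lia.
  rewrite size_poly1; move: (2 ^ m)%N (size r) => x y m_lt sz_r.
  by clear -m_gt0 m_lt sz_r; apply/andP; split; lia.
have [r_gt4 r_gt2m] := andP sz_r.
exists r; split=> //.
apply: (schonemann_irreducible 2 _ (critical_orbit int 3) r u t (2 ^ m)) => //.
- by apply: leq_trans r_gt4.
- by rewrite map_critical_orbit; apply: critical_orbit3_irreducible_mod2.
- by rewrite map_critical_orbit -period3_quotient_mod2 Dr rmorphM dvdp_mulr.
rewrite map_critical_orbit.
have [_ sz3'] := critical_orbit_monic_size 'F_2 2.
have {}uE : (0 < size (pZto 'F_2 u) < 4)%N.
  case: uE => ->; first by rewrite rmorph1 size_poly1.
  by rewrite rmorphD rmorphXn /= map_polyX rmorph1 size_XnaddC.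
have [u_gt0 u_lt4] := andP uE.
(* u mod 2 is nonzero of smaller degree than P_3, so P_3 cannot divide it. *)
apply: contraL u_lt4 => /dvdp_leq; rewrite -size_poly_gt0 u_gt0 sz3' -leqNgt.
exact.
Qed.

(** * The dynamical condition *)

Section MisiurewiczParameters.

Variable R : realType.

Lemma horner_critical_orbit (a : R[i]) n :
  (critical_orbit R[i] n).[a] = iter n (unicritical 2 a) 0.
Proof.
elim: n => [|n IHn]; first by rewrite /critical_orbit /= horner0.
by rewrite critical_orbitS hornerD hornerM hornerX horner_exp hornerC IHn /=.
Qed.

(** If z (m+1) = - z m then z (m+1) and z m have the same image, so z (m+1) is
    fixed; if z 3 = 0 then 0 itself is periodic.  Conversely z (m+3) = - z m
    gives z (m+4) = z (m+1), so z (m+1) has period 1 or 3.  Were it fixed, then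
    z (m+1) = z (m+3) = - z m, against the second condition.  Were an earlier
    point of the orbit periodic, then z m would lie on the cycle, whence
    z m = z (m+3) = - z m, so that z m = 0 = z (m+3) and z 3 = 0. *)
Lemma misiurewicz_period3P (m : nat) (a : R[i]) :
  let z n := iter n (unicritical 2 a) 0 in
  misiurewicz 2 m.+1 3 2 a <->
    [/\ z m.+3 + z m = 0, z m.+1 + z m != 0 & z 3 != 0].
Proof.
move=> z; pose f := unicritical 2 a.
have zE n : iter n f 0 = z n by [].
have zS n : z n.+1 = a * z n ^+ 2 + 1 by rewrite /z iterS.
have z0 : z 0 = 0 by [].
have iterz i n : iter i f (z n) = z (i + n)%N by rewrite -!zE -iterD.
rewrite /misiurewicz /mkset -/f; clearbody z f.
have z1 : z 1 = 1 by rewrite zS z0 expr0n mulr0 add0r.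
have zN i j : z i + z j = 0 -> z i.+1 = z j.+1.
  by move=> /addr0_eq; rewrite !zS => <-; rewrite sqrrN.
have neg1 : -1 != 1 :> R[i] by rewrite eq_sym -subr_eq0 opprK -mulr2n pnatr_eq0.
have last_index : (m.+1 + 3).-1 = m.+3 by lia.
rewrite last_index succnK !zE.
split.
  case=> -[per_m notper] [w w_prim z_eq].
  case: per_m; rewrite zE => _ per_m per_min.
  have w1 : w = -1.
    have := prim_expr_order w_prim => /eqP; rewrite sqrf_eq1 => /pred2P[w1|//].
    by have := prim_order_dvd w_prim 1; rewrite expr1 w1 eqxx.
  have zm : z m.+3 + z m = 0 by rewrite z_eq w1 mulN1r addNr.
  split=> //.
    by apply/eqP=> /zN zm1; apply: (per_min 1%N) => //; rewrite iterz.
  apply/eqP=> z3.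
  apply: (notper 0%N) => //; exists 3; rewrite zE; split=> //.
    by rewrite iterz z0.
  case=> [|[|[|i]]] // _; rewrite iterz addn0 z0.
    by rewrite z1; apply/eqP; rewrite oner_eq0.
  by move=> z2; move: z3 => /eqP; rewrite zS z2 expr0n mulr0 add0r oner_eq0.
case=> zm3 zm1 z3.
have zm4 := zN _ _ zm3.
have zm_neq0 : z m != 0.
  apply: contra_neq z3 => zm0; move: zm3.
  by rewrite -(add3n m) -iterz zm0 addr0 -z0 iterz.
have zm2 : z m.+2 <> z m.+1.
  move=> zm2; have zm31 : z m.+3 = z m.+1 by rewrite zS zm2 -zS.
  by move: zm1; rewrite -zm31 zm3 eqxx.
have periodic_m : iter 3 f (z m) <> z m.
  rewrite iterz add3n => zm30; move: zm3; rewrite zm30 -mulr2n => /eqP.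
  by rewrite mulrn_eq0 (negPf zm_neq0).
have prim_neg1 : 2.-primitive_root (-1 : R[i]).
  apply/andP; split=> //; apply/forallP=> -[[|[|//]] lt_i] //=.
    by rewrite unity_rootE expr1 (negPf neg1).
  by rewrite unity_rootE sqrrN expr1n !eqxx.
split; last first.
  exists (-1) => //; rewrite mulN1r.
  by apply/eqP; rewrite -addr_eq0; exact/eqP.
split.
  rewrite zE; split=> //; first by rewrite iterz add3n zm4.
  case=> [|[|[|i]]] // _; rewrite iterz ?add1n ?add2n //.
  by move=> zm31; apply: zm2; rewrite -zm4 [RHS]zS zm31 -zS.
move=> j lt_jm [n]; rewrite zE => -[n_gt0 per_n _]; apply: periodic_m.
have per_nm : iter n f (z m) = z m.
  rewrite iterz -(subnK (_ : j <= m)%N) // addnCA -iterz.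
  by rewrite -[z (n + j)%N]iterz per_n iterz.
rewrite -{1}per_nm !iterz (_ : 3 + (n + m) = n.-1 + m.+4)%N; last by lia.
rewrite -iterz zm4 iterz (_ : n.-1 + m.+1 = n + m)%N; last by lia.
by rewrite -iterz.
Qed.

End MisiurewiczParameters.

(** * Roots of irreducible integer polynomials *)

Lemma irreducible_coprime_size (F : fieldType) (p q : {poly F}) :
  irreducible_poly p -> q != 0 -> (size q < size p)%N -> coprimep p q.
Proof.
move=> p_irr q_neq0 lt_qp; rewrite irreducible_poly_coprime //.
by apply: contraL lt_qp => /(dvdp_leq q_neq0); rewrite leqNgt.
Qed.

Lemma map_poly_ratr_intr (F : numFieldType) (p : {poly int}) :
  map_poly (ratr : rat -> F) (pZto rat p) = pZto F p.
Proof. by rewrite -map_poly_comp; apply: eq_map_poly => x /=; rewrite ratr_int. Qed.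

Section IrreducibleIntPoly.

Variables (F : numFieldType) (p : {poly int}).
Hypothesis p_irr : irreducible_poly p.

Let pQ_irr : irreducible_poly (pZto rat p).
Proof. exact/irreducible_rat_int. Qed.

(** Coprimality over the rationals persists over F, and excludes common roots. *)
Lemma irreducible_int_root (q : {poly int}) (x : F) :
    q != 0 -> (size q < size p)%N -> root (pZto F p) x -> (pZto F q).[x] != 0.
Proof.
move=> q_neq0 lt_qp; apply: coprimep_root.
rewrite -(map_poly_ratr_intr F p) -(map_poly_ratr_intr F q) coprimep_map.
apply: irreducible_coprime_size; rewrite ?size_rat_int_poly //.
by rewrite -size_poly_gt0 size_rat_int_poly size_poly_gt0.
Qed.

Lemma irreducible_int_separable : separable_poly (pZto F p).
Proof.
rewrite -(map_poly_ratr_intr F) separable_map separable_poly.unlock.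
have [p_gt1 _] := pQ_irr.
apply: irreducible_coprime_size => //; last first.
  by apply: lt_size_deriv; apply: irredp_neq0.
apply/eqP=> /polyP/(_ (size (pZto rat p)).-2)/eqP.
rewrite coef_deriv coef0 (_ : _.-2.+1 = (size (pZto rat p)).-1).
  rewrite -lead_coefE -mulr_natr mulf_eq0 lead_coef_eq0 pnatr_eq0.
  by rewrite (negPf (irredp_neq0 pQ_irr)) -subn1 subn_eq0 leqNgt p_gt1.
by rewrite prednK // -subn1 subn_gt0.
Qed.

End IrreducibleIntPoly.

Theorem corollary20 (R : realType) (k : nat) (hk : (2 <= k)%N) :
  exists2 r : {poly int},
    map_poly (fun z : int => z%:~R : R[i]) r = Rkn R 2 k 3 &
    irreducible_poly (map_poly (fun z : int => z%:~R : rat) r).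
Proof.
case: k hk => // m; rewrite ltnS => m_gt0.
have [r [Dr r_mon r_irr r_gt4 r_gt2m]] := irreducible_period3_factor m m_gt0.
exists r; last exact/irreducible_rat_int.
have rC_mon : pZto R[i] r \is monic by apply: monic_map.
have [s Ds] := closed_field_poly_normal (pZto R[i] r).
rewrite (monicP rC_mon) scale1r in Ds.
have s_uniq : uniq s.
  by rewrite -separable_prod_XsubC -Ds; apply: irreducible_int_separable.
have in_s a : (a \in s) = root (pZto R[i] r) a by rewrite Ds root_prod_XsubC.
have evalP a n :
    (pZto R[i] (critical_orbit int n)).[a] = iter n (unicritical 2 a) 0.
  by rewrite map_critical_orbit horner_critical_orbit.
have evalD a i j :
    (pZto R[i] (critical_orbit int i + critical_orbit int j)).[a] =
      iter i (unicritical 2 a) 0 + iter j (unicritical 2 a) 0.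
  by rewrite map_critical_orbitD hornerD !horner_critical_orbit.
have [mon3 sz3] := critical_orbit_monic_size int 2.
have [q_mon sz_q] : critical_orbit int m.+1 + critical_orbit int m \is monic /\
    size (critical_orbit int m.+1 + critical_orbit int m) = (2 ^ m)%N.
  have := critical_orbitD_monic_size int m.-1 0.
  by rewrite addn2 addn1 !prednK.
have misiurewicz_root : misiurewicz 2 m.+1 3 2 = [set` s]%classic.
  apply/seteqP; split=> a /=; rewrite in_s.
    move=> /(misiurewicz_period3P R m a) [z_eq q_neq0 z3_neq0].
    move: z_eq; rewrite -evalD period3_quotientE rmorphM hornerM evalD => /eqP.
    rewrite mulf_eq0 (negPf q_neq0) orFb Dr rmorphM hornerM mulf_eq0 => /orP[//|].
    case: ifP => _; first by rewrite evalP (negPf z3_neq0).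
    by rewrite rmorph1 hornerC oner_eq0.
  move=> r_root; apply/(misiurewicz_period3P R m a); split.
  - rewrite -evalD period3_quotientE Dr !rmorphM !hornerM.
    by rewrite (rootP r_root) mul0r mulr0.
  - rewrite -evalD; apply: irreducible_int_root r_root => //.
      exact: monic_neq0.
    by rewrite sz_q.
  rewrite -evalP; apply: irreducible_int_root r_root => //.
    exact: monic_neq0.
  by rewrite sz3.
have -> : pZto R[i] r = Rknd R 2 m.+1 3 2.
  by rewrite /Rknd misiurewicz_root -fsbig_seq.
rewrite /Rkn.
have -> : divisors 2 = [:: 1; 2]%N by [].
by rewrite !big_cons big_nil mulr1.
Qed.
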